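(* Let $Q$ be a finite connected quiver and $d=(d_i)_{i\in Q_0}$ a dimension vector with $d_i\ge 1$ for all $i\in Q_0$. If $Q$ admits a self-stable representation of dimension $d$, then $Q$ is strongly connected.
   Context: $Q_0$ is the set of nodes and $Q_1$ the set of arrows $a$, with source $s(a)$ and target $t(a)$. $Q$ is strongly connected if for any two nodes $i,j$ there is an oriented path from $i$ to $j$ and an oriented path from $j$ to $i$. Representations are over $\mathbb{C}$: a representation of dimension $d$ is a family of linear maps $\phi_a:\mathbb{C}^{d_{s(a)}}\to\mathbb{C}^{d_{t(a)}}$, $a\in Q_1$. Self-stability for dimension vector $d$: let $\zeta_i=\sum_{a\in Q_1:\,t(a)=i}d_{s(a)}-\sum_{a\in Q_1:\,s(a)=i}d_{t(a)}$ for $i\in Q_0$ (equivalently $\zeta_i=-\sum_{j\neq i}\kappa_{ij}d_j$ with $\kappa_{ij}$ the signed number of arrows from $i$ to $j$); then $\sum_i d_i\zeta_i=0$. A representation $\phi$ of dimension $d$ is self-stable if every nonzero proper subrepresentation, of dimension vector $d'$, satisfies $\sum_{i\in Q_0}\zeta_i d'_i<0$. *)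

(* Defs.v *)
From mathcomp Require Import all_boot all_order all_algebra.

Set Implicit Arguments.
Unset Strict Implicit.
Unset Printing Implicit Defensive.

Import Order.TTheory GRing.Theory Num.Theory.
Local Open Scope ring_scope.

Record quiver := Quiver {
  node : finType;
  arrow : finType;
  src : arrow -> node;
  tgt : arrow -> node }.

Definition adj (Q : quiver) : rel (node Q) :=
  fun i j => [exists a : arrow Q, (src a == i) && (tgt a == j)].

(* Connectedness of the underlying unoriented graph. *)
Definition connected (Q : quiver) : Prop :=
  forall i j : node Q, connect (fun k l => adj k l || adj l k) i j.

(* [connect] is reflexive: the trivial path at a node counts as a path. *)
Definition strongly_connected (Q : quiver) : Prop :=
  forall i j : node Q, connect (@adj Q) i j /\ connect (@adj Q) j i.

Definition representation (F : fieldType) (Q : quiver) (d : node Q -> nat) :=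
  forall a : arrow Q, 'Hom('cV[F]_(d (src a)), 'cV[F]_(d (tgt a))).

Definition subspaces (F : fieldType) (Q : quiver) (d : node Q -> nat) :=
  forall i : node Q, {vspace 'cV[F]_(d i)}.

Definition subrepresentation (F : fieldType) (Q : quiver) (d : node Q -> nat)
    (phi : representation F d) (U : subspaces F d) : Prop :=
  forall a : arrow Q, (phi a @: U (src a) <= U (tgt a))%VS.

Definition zeta (Q : quiver) (d : node Q -> nat) (i : node Q) : int :=
  \sum_(a : arrow Q | tgt a == i) (d (src a))%:Z
  - \sum_(a : arrow Q | src a == i) (d (tgt a))%:Z.

Definition self_stable (F : fieldType) (Q : quiver) (d : node Q -> nat)
    (phi : representation F d) : Prop :=
  forall U : subspaces F d,
    subrepresentation phi U ->
    (exists i : node Q, U i != 0%VS) ->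
    (exists i : node Q, U i != fullv) ->
    \sum_(i : node Q) zeta d i * (\dim (U i))%:Z < 0.

(* Main.v *)
(* The nodes reachable from i form a set S closed under arrows, so the full
   spaces on S and zero elsewhere form a subrepresentation.  Its zeta-weight is
   the sum of d(s(a)) d(t(a)) over the arrows a entering S from outside, hence
   nonnegative, and stability forces S to contain every node. *)

Require Import Defs.
From mathcomp Require Import all_boot all_order all_algebra.
From mathcomp Require Import reals.
From mathcomp.real_closed Require Import complex.

Set Implicit Arguments.
Unset Strict Implicit.
Unset Printing Implicit Defensive.

Import Order.TTheory GRing.Theory Num.Theory.
Local Open Scope ring_scope.

(** Exchanging summations turns the weight into a sum over arrows, so its sign can be read off arrow
    by arrow. *)
Lemma zeta_pairing (Q : quiver) (d x : node Q -> nat) :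
  \sum_(i : node Q) zeta d i * (x i)%:Z =
  \sum_(a : arrow Q) ((d (src a))%:Z * (x (tgt a))%:Z
                       - (d (tgt a))%:Z * (x (src a))%:Z).
Proof.
(* Working from the right-hand side, group the positive terms by target and the negative ones by
   source, as in [zeta]. *)
rewrite sumrB (partition_big (@tgt Q) predT) //=.
rewrite [X in _ - X](partition_big (@src Q) predT) //= -sumrB.
apply: eq_bigr => i _; rewrite /zeta mulrBl !mulr_suml.
by congr (_ - _); apply: eq_bigr => a /eqP ->.
Qed.

Definition supported_on (F : fieldType) (Q : quiver) (d : node Q -> nat)
    (S : pred (node Q)) : subspaces F d :=
  fun i => if S i then fullv else 0%VS.

Lemma dim_supported_on (F : fieldType) (Q : quiver) (d : node Q -> nat)
    (S : pred (node Q)) (i : node Q) :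
  \dim (supported_on F d S i) = (S i * d i)%N.
Proof.
rewrite /supported_on; case: (S i); last by rewrite dimv0 mul0n.
by rewrite dimvf /dim /= muln1 mul1n.
Qed.

Lemma supported_on_subrepresentation (F : fieldType) (Q : quiver)
    (d : node Q -> nat) (phi : representation F d) (S : pred (node Q)) :
  (forall a : arrow Q, S (src a) -> S (tgt a)) ->
  subrepresentation phi (supported_on F d S).
Proof.
move=> Sclosed a; rewrite /supported_on.
case Ssrc: (S (src a)); last by rewrite limg0 sub0v.
by rewrite (Sclosed a Ssrc) subvf.
Qed.

Lemma zeta_supported_on_ge0 (F : fieldType) (Q : quiver) (d : node Q -> nat)
    (S : pred (node Q)) :
  (forall a : arrow Q, S (src a) -> S (tgt a)) ->
  0 <= \sum_(i : node Q) zeta d i * (\dim (supported_on F d S i))%:Z.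
Proof.
move=> Sclosed; rewrite (zeta_pairing d (fun i => \dim (supported_on F d S i))).
apply: sumr_ge0 => a _; rewrite !dim_supported_on subr_ge0 -!PoszM lez_nat.
(* Factoring out [d (src a) * d (tgt a)] leaves [S (src a) <= S (tgt a)] as numbers 0 or 1, which is
   closedness of [S]. *)
rewrite mulnCA [(d (src a) * _)%N]mulnCA [(d (tgt a) * _)%N]mulnC leq_mul2r.
by case Ssrc: (S (src a)); rewrite ?(Sclosed a Ssrc) ?orbT.
Qed.

(** If [S] missed [j], its subrepresentation would be nonzero at [i] and proper at [j], as [d] is
    positive at both; stability would then make its nonnegative weight negative. *)
Lemma self_stable_closed_full (F : fieldType) (Q : quiver) (d : node Q -> nat)
    (phi : representation F d) (S : pred (node Q)) (i j : node Q) :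
  (forall k : node Q, (1 <= d k)%N) -> self_stable phi ->
  (forall a : arrow Q, S (src a) -> S (tgt a)) -> S i -> S j.
Proof.
move=> d_ge1 phi_stable Sclosed Si; apply/negPn/negP => /negPf Sj.
have := zeta_supported_on_ge0 F d Sclosed.
rewrite leNgt => /negP; apply; apply: phi_stable.
- exact: supported_on_subrepresentation.
- by exists i; rewrite -dimv_eq0 dim_supported_on Si mul1n -lt0n.
- exists j; apply/eqP => /(congr1 (fun U => \dim U)).
  rewrite dim_supported_on Sj mul0n dimvf /dim /= muln1 => dj0.
  by have := d_ge1 j; rewrite -dj0.
Qed.

Theorem proposition3p1 (R : realType) (Q : quiver) (d : node Q -> nat)
    (Qconn : connected Q) (d_ge1 : forall i : node Q, (1 <= d i)%N)
    (Qstab : exists phi : representation R[i] d, self_stable phi) :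
  strongly_connected Q.
Proof.
case: Qstab => phi phi_stable.
have reach k l : connect (@adj Q) k l.
  (* The set reachable from [k] contains [k] by the trivial path and is closed because a path can be
     prolonged by an arrow. *)
  apply: (self_stable_closed_full (S := connect (@adj Q) k) (i := k))
    d_ge1 phi_stable _ (connect0 _ _) => a ka.
  apply: connect_trans ka (connect1 _).
  by apply/existsP; exists a; rewrite !eqxx.
by move=> i j.
Qed.
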